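(* (i) Let $R\in\mathbb{N}_0$ and let $u:B_R\to\mathbb{R}$ be harmonic, where $B_R\subseteq\mathbb{Z}^d$. Then the function $Q_u$ is absolutely monotonic in $[0,R]$ in the discrete sense. (ii) If $u:\mathbb{Z}^d\to\mathbb{R}$ is harmonic on all of $\mathbb{Z}^d$ and $Q_{c,u}$ is finite on $[0,T)$, then $Q_{c,u}$ is absolutely monotonic in $[0,T)$.
   Context: $\mathbb{Z}^d$ carries its standard nearest-neighbour graph structure, $|x|_1$ denotes graph distance from $0$, and $B_R=\{x\in\mathbb{Z}^d:|x|_1\le R\}$. The Laplacian is $(\Delta f)(x)=\frac{1}{2d}\sum_{y\sim x}(f(y)-f(x))$. A function $u:B_R\to\mathbb{R}$ is harmonic if $(\Delta u)(x)=0$ at every $x$ all of whose neighbours lie in $B_R$ (i.e. $|x|_1\le R-1$); $u:\mathbb{Z}^d\to\mathbb{R}$ is harmonic if $\Delta u\equiv 0$. $(X_n)_{n\ge 0}$ is the simple random walk on $\mathbb{Z}^d$ starting at $0$, and $(Y_t)_{t\ge0}$ is the rate-one continuous time simple random walk starting at $0$ (generator $\Delta$). $Q_u(n):=\mathbb{E}(u(X_n)^2)$ for integers $0\le n\le R$, and $Q_{c,u}(t):=\mathbb{E}(u(Y_t)^2)\in[0,\infty]$ for $t\ge 0$. A function $f:\mathbb{N}_0\cap[0,R]\to\mathbb{R}$ is absolutely monotonic in $[0,R]$ in the discrete sense if $f^{(k)}(n)\ge0$ for all $k,n\in\mathbb{N}_0$ with $k+n\le R$, where $f^{(0)}=f$,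 $f'(n)=f(n+1)-f(n)$ and $f^{(k)}=(f^{(k-1)})'$. A $C^\infty$-function $f:[0,T)\to\mathbb{R}$ is absolutely monotonic in $[0,T)$ if $f$ and all its derivatives are non-negative there (one-sided derivatives at $0$). *)

(* Defs.v *)
From HB Require Import structures.
From mathcomp Require Import all_boot all_order all_algebra.
From mathcomp Require Import all_classical all_reals all_analysis.

Set Implicit Arguments.
Unset Strict Implicit.
Unset Printing Implicit Defensive.

Import Order.TTheory GRing.Theory Num.Theory.
Import numFieldNormedType.Exports.

Local Open Scope classical_set_scope.
Local Open Scope ring_scope.

Notation "'Z^' d" := 'rV[int]_d (at level 8, d at level 2, format "'Z^' d") :
  type_scope.

Definition l1norm (d : nat) (x : Z^d) : nat := (\sum_(i < d) `|x ord0 i|)%N.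

Definition nearest_neighbours (d : nat) (x y : Z^d) : bool :=
  l1norm (y - x) == 1%N.

Definition l1ball (d r : nat) : set (Z^d) := [set x | (l1norm x <= r)%N].

(* The sum is finitely supported, since [x] has exactly [2 * d] neighbours. *)
Definition laplacian (R : realType) (d : nat) (f : Z^d -> R) (x : Z^d) : R :=
  (2 * d)%:R^-1 * \sum_(y \in [set y | nearest_neighbours x y]) (f y - f x).

(* A function on the ball is represented by a total function; only its values
   in the ball are constrained. *)
Definition harmonic_on_ball (R : realType) (d r : nat) (u : Z^d -> R) : Prop :=
  forall x, [set y | nearest_neighbours x y] `<=` l1ball r -> laplacian u x = 0.

Definition harmonic_on_lattice (R : realType) (d : nat) (u : Z^d -> R) : Prop :=
  forall x, laplacian u x = 0.

Section RandomElements.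
Context (R : realType) (disp : measure_display) (Omega : measurableType disp)
  (P : probability Omega R).
Local Open Scope ereal_scope.

(* Random elements of a countable type, which carries its discrete
   sigma-algebra: events determined by finitely many such elements are
   countable unions of intersections of fibres, so measurability and
   independence may be stated on fibres. *)
Definition discrete_random_element (T : countType) (Z : Omega -> T) : Prop :=
  forall x, measurable [set w | Z w = x].

Definition mutually_independent (I : eqType) (T : countType)
    (Z : I -> Omega -> T) : Prop :=
  forall (s : seq I) (x : I -> T), uniq s ->
    P [set w | forall i, i \in s -> Z i w = x i] =
    \prod_(i <- s) P [set w | Z i w = x i].

Definition independent_processes (I J : eqType) (DI : set I) (DJ : set J)
    (S T : countType) (Z : I -> Omega -> S) (W : J -> Omega -> T) : Prop :=
  forall (s : seq I) (r : seq J) (x : I -> S) (y : J -> T),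
    [set` s] `<=` DI -> [set` r] `<=` DJ ->
    P ([set w | forall i, i \in s -> Z i w = x i] `&`
       [set w | forall j, j \in r -> W j w = y j]) =
    P [set w | forall i, i \in s -> Z i w = x i] *
    P [set w | forall j, j \in r -> W j w = y j].

Definition simple_random_walk (d : nat) (X : nat -> Omega -> Z^d) : Prop :=
  [/\ forall n, discrete_random_element (X n),
      forall w, X 0%N w = 0%R,
      mutually_independent (fun n w => X n.+1 w - X n w)%R
    & forall n (e : Z^d), P [set w | (X n.+1 w - X n w)%R = e] =
        (if nearest_neighbours 0%R e then (2 * d)%:R^-1 else 0)%R%:E].

(* Paths are nondecreasing, so the truncated subtraction in the increments is
   an actual one.  The law of an increment is only prescribed for [s < t]
   because [poisson_pmf] is a dummy constant at rate [0]. *)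
Definition unit_rate_poisson_process (N : R -> Omega -> nat) : Prop :=
  [/\ forall t, (0 <= t)%R -> discrete_random_element (N t),
      forall w, N 0%R w = 0%N,
      forall w,
        (forall s t, (0 <= s)%R -> (s <= t)%R -> (N s w <= N t w)%N) /\
        (forall t, (0 <= t)%R -> \forall s \near t^'+, N s w = N t w),
      forall t : nat -> R, (0 <= t 0%N)%R ->
        (forall i, (t i <= t i.+1)%R) ->
        mutually_independent (fun i w => N (t i.+1) w - N (t i) w)%N
    & forall s t, (0 <= s)%R -> (s < t)%R -> forall k : nat,
        P [set w | (N t w - N s w)%N = k] = (poisson_pmf (t - s)%R k)%:E].

(* The rate-one continuous time simple random walk: a simple random walk run
   along the jump times of an independent unit rate Poisson process. *)
Definition continuous_time_random_walk (d : nat) (Y : R -> Omega -> Z^d) :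
    Prop :=
  exists (X : nat -> Omega -> Z^d) (N : R -> Omega -> nat),
    [/\ simple_random_walk X,
        unit_rate_poisson_process N,
        independent_processes setT [set t : R | (0 <= t)%R] X N
      & forall t w, (0 <= t)%R -> Y t w = X (N t w) w].

(* Used with [I := nat] for Q_u and with [I := R] for Q_{c,u}. *)
Definition second_moment (I : Type) (d : nat) (u : Z^d -> R)
    (Z : I -> Omega -> Z^d) (i : I) : \bar R :=
  'E_P [fun w => (u (Z i w) ^+ 2)%R].

End RandomElements.

Definition discrete_derivative (R : realType) (f : nat -> R) : nat -> R :=
  fun n => f n.+1 - f n.

Definition discrete_absolutely_monotonic (R : realType) (r : nat)
    (f : nat -> R) : Prop :=
  forall k n, (k + n <= r)%N -> 0 <= iter k (@discrete_derivative R) f n.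

Section AbsolutelyMonotonic.
Context (R : realType).

(* Difference quotients are restricted to points of [A], so that derivatives
   are one-sided at an endpoint belonging to [A]. *)
Definition quotients_within (A : set R) (f : R -> R) (x : R) : set_system R :=
  (f y - f x) / (y - x) @[y --> within A x^'].

Definition derivative_within (A : set R) (f : R -> R) : R -> R :=
  fun x => lim (quotients_within A f x).

Definition nderivative_within (A : set R) (k : nat) (f : R -> R) : R -> R :=
  iter k (derivative_within A) f.

Definition smooth_within (A : set R) (f : R -> R) : Prop :=
  forall k x, A x -> cvg (quotients_within A (nderivative_within A k f) x).

Definition absolutely_monotonic (A : set R) (f : R -> R) : Prop :=
  smooth_within A f /\
  forall k x, A x -> 0 <= nderivative_within A k f x.

(* [T] may be infinite. *)
Definition initial_interval (T : \bar R) : set R :=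
  [set t | 0 <= t /\ (t%:E < T)%E].

End AbsolutelyMonotonic.

(* Main.v *)
(* The law of X_n is the n-th iterate of the averaging operator A over the
   neighbours, so Q_u(n) = (A^n u^2)(0).  For harmonic u, (A - 1)(u^2) is the
   mean over the unit steps e of u_e^2, where u_e(x) = u(x + e) - u(x); hence
   the discrete derivative of Q_u is the mean of the Q_{u_e}.  As u_e is
   harmonic on a smaller ball, (i) follows by induction.  For (ii), Q_{c,u}(t)
   is the mean of Q_u at a Poisson variable of parameter t, that is
   e^-t sum_n Q_u(n) t^n / n!, and differentiating this power series replaces
   the sequence Q_u by its discrete derivative, which is non-negative by (i). *)
Require Import Defs.
From mathcomp Require Import all_boot all_order all_algebra.
From mathcomp Require Import all_classical all_reals all_analysis.
From mathcomp Require Import measurable_realfun zify ring lra.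
Import Order.TTheory GRing.Theory Num.Theory.
Import numFieldNormedType.Exports.

Set Implicit Arguments.
Unset Strict Implicit.
Unset Printing Implicit Defensive.

Local Open Scope classical_set_scope.
Local Open Scope ring_scope.

(** * Averaging over lattice neighbours, and the mean square of a function with the mean value
    property *)

Section Lattice.
Context (d : nat).
Implicit Types x y e : Z^d.

Lemma l1normD x y : (l1norm (x + y) <= l1norm x + l1norm y)%N.
Proof.
rewrite /l1norm -big_split; apply: leq_sum => i _; rewrite mxE /=; lia.
Qed.

Definition signed_unit (p : 'I_d * bool) : Z^d :=
  \row_j (if j == p.1 then (-1) ^+ p.2 else 0).

Lemma signed_unit_inj : injective signed_unit.
Proof.
move=> [i b] [j c] /rowP h; have := h i; have := h j.
move: h => _; rewrite !mxE /= !eqxx.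
rewrite (eq_sym j i); case: eqVneq => [->|_]; last by case: b; case: c.
by case: b; case: c.
Qed.

Definition unit_steps : seq (Z^d) := [seq signed_unit p | p : 'I_d * bool].

Lemma uniq_unit_steps : uniq unit_steps.
Proof. by rewrite map_inj_uniq ?enum_uniq//; exact: signed_unit_inj. Qed.

Lemma size_unit_steps : size unit_steps = (2 * d)%N.
Proof. by rewrite size_map -cardE card_prod card_ord card_bool mulnC. Qed.

Lemma mem_unit_steps e : (e \in unit_steps) = (l1norm e == 1%N).
Proof.
apply/mapP/idP => [[[i b] _ ->]|/sum_nat_eq1[i [_ ei e0]]].
  apply/sum_nat_eq1; exists i; split=> //= [|j /negPf ji _]; rewrite mxE /=.
    by rewrite eqxx; case: b.
  by rewrite ji.
exists (i, e ord0 i < 0); first by rewrite mem_enum.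
apply/rowP => j; rewrite mxE /=; case: eqVneq => [->|ji].
  have [e1|e1] : e ord0 i = 1 \/ e ord0 i = -1 by lia.
    by rewrite e1.
  by rewrite e1.
by have := e0 j ji erefl; rewrite (_ : ord0 = 0) //; lia.
Qed.

Context (R : realType).
Implicit Types (u f g : Z^d -> R) (c : R).

Definition average f x : R :=
  (2 * d)%:R^-1 * \sum_(e <- unit_steps) f (x + e).

Lemma laplacianE f x : laplacian f x =
  (2 * d)%:R^-1 * \sum_(e <- unit_steps) (f (x + e) - f x).
Proof.
rewrite /laplacian; congr (_ * _).
rewrite -(big_map (fun e => x + e) xpredT (fun y => f y - f x)).
rewrite [RHS]fsbig_seq; last first.
  by rewrite map_inj_uniq ?uniq_unit_steps//; exact: addrI.
congr (\sum_(y \in _) _); apply/seteqP.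
split=> y /=; rewrite /nearest_neighbours.
  move=> xy; apply/mapP; exists (y - x); last by rewrite addrC subrK.
  by rewrite mem_unit_steps.
by move=> /mapP[e es ->]; rewrite addrAC subrr add0r -mem_unit_steps.
Qed.

Lemma average_sub (hd : (0 < d)%N) f x : average f x - f x =
  (2 * d)%:R^-1 * \sum_(e <- unit_steps) (f (x + e) - f x).
Proof.
rewrite /average big_split /= mulrDr; congr (_ + _).
rewrite big_const_seq count_predT size_unit_steps iter_addr_0.
rewrite -[X in _ * X]mulr_natl mulrA.
by rewrite mulVf ?mul1r// pnatr_eq0; lia.
Qed.

(** Each averaging step moves by distance one, so [n] of them read values only within distance [n].
    This lets identities valid only inside a ball be used under the iterated average. *)
Lemma eq_iter_average n f g x :
  (forall y, (l1norm (y - x) <= n)%N -> f y = g y) ->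
  iter n average f x = iter n average g x.
Proof.
elim: n x => [|n IHn] x fg.
  apply: fg; rewrite subrr leqn0 sum_nat_eq0; apply/forallP => i.
  by rewrite mxE.
rewrite !iterS /average; congr (_ * _); apply: eq_big_seq => e.
rewrite mem_unit_steps => /eqP e1; apply: IHn => y yx; apply: fg.
have -> : y - x = y - (x + e) + e by rewrite opprD addrA subrK.
by rewrite (leq_trans (l1normD _ _))// e1 addn1.
Qed.

Lemma iter_average_sum n (I : Type) (s : seq I) (F : I -> Z^d -> R) c x :
  iter n average (fun y => c * \sum_(i <- s) F i y) x =
  c * \sum_(i <- s) iter n average (F i) x.
Proof.
elim: n x => // n IHn x; rewrite iterS /average.
under eq_bigr do rewrite IHn.
rewrite -mulr_sumr mulrCA exchange_big /=; congr (_ * _).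
by rewrite mulr_sumr.
Qed.

Lemma iter_averageB n f g x :
  iter n average (fun y => f y - g y) x =
  iter n average f x - iter n average g x.
Proof.
elim: n x => // n IHn x; rewrite !iterS /average -mulrBr -sumrB.
by congr (_ * _); apply: eq_bigr => e _; rewrite IHn.
Qed.

Lemma iter_average_ge0 n f x : (forall y, 0 <= f y) -> 0 <= iter n average f x.
Proof.
move=> f0; elim: n x => // n IHn x; rewrite iterS /average.
by rewrite mulr_ge0 ?invr_ge0 ?ler0n// sumr_ge0.
Qed.

Definition increment e u x := u (x + e) - u x.

(** The strict bound keeps all neighbours of [x] in the ball of radius [r]. Phrased by the norm of
    the centre, the property passes to increments at radius [r.-1]. *)
Definition mean_value (r : nat) u :=
  forall x, (l1norm x < r)%N -> average u x = u x.

Lemma harmonic_on_ball_mean_value (hd : (0 < d)%N) r u :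
  harmonic_on_ball r u -> mean_value r u.
Proof.
move=> hu x xr; apply/eqP; rewrite -subr_eq0 average_sub// -laplacianE.
apply/eqP; apply: hu => y /eqP yx.
rewrite /l1ball /= -(subrK x y) (leq_trans (l1normD _ _))//.
by rewrite yx add1n.
Qed.

Lemma mean_value_increment r u e : e \in unit_steps ->
  mean_value r u -> mean_value r.-1 (increment e u).
Proof.
rewrite mem_unit_steps => /eqP e1 hu x xr.
have xer : (l1norm (x + e)%R < r)%N.
  by have := l1normD x e; lia.
rewrite /increment -(hu x) -?(hu _ xer); last by lia.
rewrite /average -mulrBr -sumrB; congr (_ * _); apply: eq_bigr => f _.
by rewrite addrAC.
Qed.

(** In [a^2 - b^2 = (a - b)^2 + 2 b (a - b)] with [a = u (x + e)] and [b = u x], the cross terms sum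
    to a multiple of the Laplacian of [u] at [x], which vanishes. *)
Lemma average_sqr_mean_value (hd : (0 < d)%N) r u x :
  mean_value r u -> (l1norm x < r)%N ->
  average (fun y => u y ^+ 2) x - u x ^+ 2 =
  (2 * d)%:R^-1 * \sum_(e <- unit_steps) increment e u x ^+ 2.
Proof.
move=> hu xr; rewrite average_sub//.
have /eqP := hu x xr; rewrite -subr_eq0 average_sub// => /eqP ux.
apply/eqP; rewrite -subr_eq0 -mulrBr -sumrB.
rewrite (eq_bigr (fun e => (2 * u x) * (u (x + e) - u x))); last first.
  by move=> e _; rewrite /increment; ring.
by rewrite -mulr_sumr mulrCA ux mulr0.
Qed.

Definition mean_square u n := iter n average (fun y => u y ^+ 2) 0.

Lemma discrete_derivative_mean_square (hd : (0 < d)%N) r u n :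
  mean_value r u -> (n < r)%N ->
  discrete_derivative (mean_square u) n =
  (2 * d)%:R^-1 * \sum_(e <- unit_steps) mean_square (increment e u) n.
Proof.
move=> hu nr; rewrite /discrete_derivative /mean_square -iter_average_sum.
(* The extra averaging step is taken innermost, next to the square; the remaining [n] steps from the
   origin stay at norm at most [n < r]. *)
rewrite iterSr -iter_averageB; apply: eq_iter_average => y; rewrite subr0 => yn.
exact: (average_sqr_mean_value hd hu (leq_ltn_trans yn nr)).
Qed.

Lemma eq_iter_discrete_derivative (a b : nat -> R) k n :
  (forall m, (m <= k + n)%N -> a m = b m) ->
  iter k (@discrete_derivative R) a n = iter k (@discrete_derivative R) b n.
Proof.
elim: k n => [|k IHk] n ab; first exact: ab.
rewrite !iterS /discrete_derivative.
by rewrite !IHk// => m mk; apply: ab; lia.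
Qed.

Lemma iter_discrete_derivative_sum k n (I : Type) (s : seq I)
    (F : I -> nat -> R) c :
  iter k (@discrete_derivative R) (fun m => c * \sum_(i <- s) F i m) n =
  c * \sum_(i <- s) iter k (@discrete_derivative R) (F i) n.
Proof.
elim: k n => // k IHk n; rewrite iterS {1}/discrete_derivative !IHk.
by rewrite -mulrBr -sumrB.
Qed.

(** Induction on [k] over all radii and functions at once: each discrete derivative replaces [u] by
    its increments and costs one unit of radius, as the constraint [k + n <= r] allows. *)
Lemma mean_square_absolutely_monotonic (hd : (0 < d)%N) r u :
  mean_value r u -> discrete_absolutely_monotonic r (mean_square u).
Proof.
move=> + k; elim: k r u => [|k IHk] r u hu n nr.
  by apply: iter_average_ge0 => y; exact: sqr_ge0.
rewrite iterSr (@eq_iter_discrete_derivative _ (fun m => (2 * d)%:R^-1 *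
    \sum_(e <- unit_steps) mean_square (increment e u) m)); last first.
  by move=> m mkn; apply: (discrete_derivative_mean_square hd hu); lia.
rewrite iter_discrete_derivative_sum mulr_ge0 ?invr_ge0 ?ler0n//.
rewrite big_seq sumr_ge0// => e es.
apply: (IHk r.-1); last by lia.
exact: mean_value_increment.
Qed.

End Lattice.

(** * Measurability of random elements of a countable type *)

Section DiscreteRandomElement.
Context (disp : measure_display) (Omega : measurableType disp) (T : countType).
Context (Z : Omega -> T) (mZ : discrete_random_element Z).

Lemma discrete_random_element_preimage (B : set T) : measurable (Z @^-1` B).
Proof.
rewrite (_ : _ @^-1` _ =
    \bigcup_x (if x \in B then [set w | Z w = x] else set0)).
  apply: countable_bigcupT_measurable => [|x]; first exact: countableP.
  by case: ifP => _; [exact: mZ|exact: measurable0].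
apply/seteqP; split=> [w Bw|w [x _]]; first by exists (Z w); rewrite // mem_set.
by case: ifPn => // + /= => /[swap] <- /set_mem.
Qed.

Lemma discrete_random_element_comp (disp' : measure_display)
    (U : measurableType disp') (D : set Omega) (g : T -> U) :
  measurable_fun D (g \o Z).
Proof.
apply: measurable_funS (measurableT) (@subsetT _ _) _ => _ B mB.
by rewrite setTI comp_preimage; exact: discrete_random_element_preimage.
Qed.

End DiscreteRandomElement.

(** * Expectations along the simple random walk *)

Section SimpleRandomWalk.
Context (R : realType) (d : nat) (hd : (0 < d)%N).
Context (disp : measure_display) (Omega : measurableType disp).
Context (P : probability Omega R) (X : nat -> Omega -> Z^d).
Context (rwX : simple_random_walk P X).
Implicit Types (x : nat -> Z^d) (e : Z^d) (g : Z^d -> R) (D : set Omega).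

Let mX n : discrete_random_element (X n). Proof. by case: rwX. Qed.

(** Stated by membership in a list so as to match the events in [independent_processes]. *)
Definition prefix_event x n : set Omega :=
  [set w | forall j, j \in iota 0 n.+1 -> X j w = x j].

Lemma measurable_prefix_event x n : measurable (prefix_event x n).
Proof.
rewrite (_ : prefix_event x n =
    \bigcap_(j in [set` iota 0 n.+1]) [set w | X j w = x j]).
  by apply: bigcap_measurableType => j _; exact: mX.
by apply/seteqP; split=> w h j; exact: h.
Qed.

(** Since the walk starts at [0], positions and increments determine each other; the event becomes
    one about independent increments. *)
Lemma prefix_eventE x n : x 0%N = 0 -> prefix_event x n =
  [set w | forall i, i \in iota 0 n -> X i.+1 w - X i w = x i.+1 - x i].
Proof.
have [_ X0 _ _] := rwX.
move=> x0; apply/seteqP; split=> w h i; rewrite mem_iota add0n => /= ilt.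
  by rewrite !h// mem_iota add0n /=; lia.
elim: i ilt => [|i IHi] ilt; first by rewrite X0 x0.
rewrite -(subrK (X i w) (X i.+1 w)) h; last by rewrite mem_iota /=; lia.
by rewrite IHi ?subrK//; lia.
Qed.

Definition extend_prefix x n e : nat -> Z^d :=
  fun j => if (j <= n)%N then x j else x n + e.

Lemma prefix_event_extend x n e : prefix_event (extend_prefix x n e) n.+1 =
  prefix_event x n `&` [set w | X n.+1 w = x n + e].
Proof.
apply/seteqP; split=> [w h|w [h hn] j].
  split=> [j|]; last first.
    by have := h n.+1; rewrite mem_iota /extend_prefix ltnn /=; apply; lia.
  rewrite mem_iota add0n /= => jn.
  by have := h j; rewrite mem_iota /extend_prefix -(ltnS j n) jn; apply; lia.
rewrite mem_iota add0n /extend_prefix /= => jn; case: ifPn => jn'.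
  by apply: h; rewrite mem_iota.
by rewrite (_ : j = n.+1) //; lia.
Qed.

Lemma probability_prefix_event_extend x n e : x 0%N = 0 -> e \in unit_steps d ->
  P (prefix_event (extend_prefix x n e) n.+1) =
  (P (prefix_event x n) * (2 * d)%:R^-1%:E)%E.
Proof.
move=> x0 es; have [_ _ indep law] := rwX.
rewrite !prefix_eventE ?x0//.
rewrite (indep _ (fun i => extend_prefix x n e i.+1 - extend_prefix x n e i));
  last exact: iota_uniq.
rewrite (indep _ (fun i => x i.+1 - x i)); last exact: iota_uniq.
rewrite -addn1 iotaD big_cat /= big_seq1 add0n; congr (_ * _)%E.
  apply: eq_big_seq => i; rewrite mem_iota add0n /= => ilt.
  by rewrite /extend_prefix ilt (ltnW ilt).
rewrite law /extend_prefix leqnn ltnn (addrC (x n)) addrK.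
by rewrite /nearest_neighbours subr0 -mem_unit_steps es.
Qed.

(* Conditionally on an initial segment of the path, and on an event
   independent of it, the next step splits the event into [2 * d] pieces of
   equal probability. *)
Lemma integral_prefix_event g D n m x : (forall y, 0 <= g y) ->
  measurable D ->
  (forall y k, P (prefix_event y k `&` D) = P (prefix_event y k) * P D)%E ->
  x 0%N = 0 ->
  (\int[P]_(w in prefix_event x m `&` D) (g (X (m + n) w))%:E =
   P (prefix_event x m `&` D) * (iter n (@average d R) g (x m))%:E)%E.
Proof.
(* [m] and [x] stay general: the known prefix grows by one step as the remaining time [n]
   shrinks. *)
move=> g0 mD ind; elim: n m x => [|n IHn] m x x0.
  rewrite addn0 (eq_integral (cst (g (x m))%:E)); last first.
    move=> w /[!inE] -[h _]; rewrite h//.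
    by rewrite mem_iota leq0n add0n ltnSn.
  rewrite integral_cst 1?muleC//.
  by apply: measurableI => //; exact: measurable_prefix_event.
pose A := prefix_event x m `&` D.
pose C e := prefix_event (extend_prefix x m e) m.+1 `&` D.
have mA : measurable A.
  by apply: measurableI => //; exact: measurable_prefix_event.
have mC e : measurable (C e).
  by apply: measurableI => //; exact: measurable_prefix_event.
have tC : trivIset [set` unit_steps d] C.
  move=> e f _ _ [w []]; rewrite /C !prefix_event_extend => -[[_ we] _].
  by move=> [[_ wf] _]; move: we; rewrite /= wf => /addrI.
pose U := \big[setU/set0]_(e <- unit_steps d) C e.
have mU : measurable U by apply: bigsetU_measurable.
have UA : U `<=` A.
  rewrite /U -bigcup_seq => w [e _]; rewrite /C prefix_event_extend.
  by move=> [[? ?] ?].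
have PC e : e \in unit_steps d -> P (C e) = (P A * (2 * d)%:R^-1%:E)%E.
  move=> es; rewrite /C ind probability_prefix_event_extend// /A ind.
  by rewrite muleAC.
have finA : P A \is a fin_num by exact: fin_num_measure.
(* Integrating the constant [1] over the [2 * d] disjoint pieces, each of mass [P A / (2 * d)],
   gives the mass of their union. *)
have PU : P U = P A.
  have := @ge0_integral_bigsetU _ _ _ P _ C (cst 1%E) (unit_steps d) mC
    (uniq_unit_steps d) tC.
  rewrite /= integral_cst// mul1e => -> //.
  rewrite (@eq_big_seq _ _ _ _ _ _ (fun=> (fine (P A) * (2 * d)%:R^-1)%:E)).
    rewrite sumEFin big_const_seq count_predT size_unit_steps iter_addr_0.
    rewrite -[X in X%:E]mulr_natr -mulrA mulVf ?mulr1 ?fineK// pnatr_eq0; lia.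
  move=> e es; rewrite integral_cst// mul1e [LHS](PC e es) EFinM fineK//.
(* The steps are unit steps only almost surely; the exceptional paths form a null set and drop out
   of the integral. *)
have PAU : P (A `\` U) = 0.
  rewrite measureD//; last by rewrite ltey_eq finA.
  by rewrite setIidr// [X in (_ - X)%E]PU subee.
have mgX D' k : measurable_fun D' (EFin \o (g \o X k)).
  exact: (discrete_random_element_comp (mX k) (EFin \o g)).
have -> : prefix_event x m `&` D = U `|` (A `\` U).
  by rewrite setDUK.
rewrite ge0_integral_setU//; last 4 first.
- exact: measurableD.
- exact: mgX.
- by move=> w _; rewrite lee_fin.
- by rewrite disj_set2E setDIK.
rewrite [X in (_ + X)%E]null_set_integral//; last 2 first.
- exact: measurableD.
- exact: mgX.
rewrite adde0 ge0_integral_bigsetU//; last 3 first.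
- exact: uniq_unit_steps.
- exact: mgX.
- by move=> w _; rewrite lee_fin.
rewrite (@eq_big_seq _ _ _ _ _ _ (fun e => (fine (P A) *
    ((2 * d)%:R^-1 * iter n (@average d R) g (x m + e)))%:E)); last first.
  move=> e es; rewrite addnS -addSn IHn; last by rewrite /extend_prefix x0.
  by rewrite -/(C e) PC// /extend_prefix ltnn mulrA !EFinM fineK.
rewrite sumEFin -!mulr_sumr EFinM fineK//.
by rewrite setDUK.
Qed.

(** The prefix of length zero is the sure event. [D] is the whole space for the discrete walk, and
    the event that the Poisson clock shows a given value for the continuous one. *)
Lemma integral_random_walk g D n : (forall y, 0 <= g y) -> measurable D ->
  (forall y k, P (prefix_event y k `&` D) = P (prefix_event y k) * P D)%E ->
  (\int[P]_(w in D) (g (X n w))%:E = P D * (iter n (@average d R) g 0)%:E)%E.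
Proof.
move=> g0 mD ind.
have := integral_prefix_event (x := fun=> 0) n 0 g0 mD ind erefl.
rewrite add0n (_ : prefix_event _ _ = setT) ?setTI//.
apply/seteqP; split=> // w _ j; rewrite mem_iota add0n => /= j0.
by have [_ X0 _ _] := rwX; rewrite (_ : j = 0%N) ?X0//; lia.
Qed.

Lemma second_moment_random_walk (u : Z^d -> R) n :
  second_moment P u X n = (mean_square u n)%:E.
Proof.
rewrite /second_moment unlock.
rewrite (integral_random_walk (g := fun y => u y ^+ 2))//.
- by rewrite probability_setT mul1e.
- by move=> y; exact: sqr_ge0.
- by move=> y k; rewrite setIT probability_setT mule1.
Qed.

End SimpleRandomWalk.

(** * The continuous time second moment as a Poisson mixture *)

Section ContinuousTimeRandomWalk.
Context (R : realType) (d : nat) (hd : (0 < d)%N).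
Context (disp : measure_display) (Omega : measurableType disp).
Context (P : probability Omega R).

(* At [t = 0] the formula still holds, since [0 ^+ 0 = 1], whereas
   [poisson_pmf] has a dummy value there. *)
Lemma poisson_process_law (N : R -> Omega -> nat) t k :
  unit_rate_poisson_process P N -> 0 <= t ->
  P [set w | N t w = k] = (t ^+ k / k`!%:R * expR (- t))%:E.
Proof.
move=> [_ N0 _ _ law]; rewrite le_eqVlt => /predU1P[<-|t0]; last first.
  have := law 0 t (lexx _) t0 k; rewrite subr0 /poisson_pmf t0 => <-.
  by congr (P _); apply/seteqP; split=> w /=; rewrite N0 subn0.
rewrite oppr0 expR0 mulr1; case: k => [|k].
  rewrite expr0 fact0 divr1 -(probability_setT P); congr (P _).
  by apply/seteqP; split=> w //= _; exact: N0.
rewrite expr0n mul0r -[RHS](measure0 P); congr (P _).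
by apply/seteqP; split=> w //=; rewrite N0.
Qed.

(** Split according to the number [k] of jumps up to [t]: on that event [Y t] is [X k], and
    independence of clock and walk factors the integral. The identity is one in [[0, +oo]]. *)
Lemma second_moment_continuous_time (Y : R -> Omega -> Z^d) (u : Z^d -> R) t :
  continuous_time_random_walk P Y -> 0 <= t ->
  second_moment P u Y t =
  (\sum_(0 <= k <oo)
    (t ^+ k / k`!%:R * expR (- t) * mean_square u k)%:E)%E.
Proof.
move=> [X [N [rwX ppN indep YE]]] t0; rewrite /second_moment unlock.
pose D k := [set w | N t w = k].
have mD k : measurable (D k) by case: ppN => + _ _ _ _; apply.
have mX n : discrete_random_element (X n) by case: rwX.
have tD : trivIset setT D by move=> i j _ _ [w [<- <-]].
have UD : \bigcup_k D k = setT.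
  by apply/seteqP; split=> // w _; exists (N t w).
have mY (B : set R) : measurable ((fun w => u (Y t w) ^+ 2) @^-1` B).
  rewrite (_ : _ @^-1` _ =
      \bigcup_k (D k `&` (X k @^-1` [set x | B (u x ^+ 2)]))).
    apply: bigcupT_measurable => k; apply: measurableI => //.
    exact: discrete_random_element_preimage.
  apply/seteqP; split=> [w|w [k _ [Dk]]]; rewrite /preimage /= YE//.
    by exists (N t w).
  by rewrite Dk.
rewrite -[X in integral _ X]UD ge0_integral_bigcup//; last 2 first.
- by apply/measurable_EFinP => _ B mB; rewrite UD setTI; exact: mY.
- by move=> w _; rewrite lee_fin sqr_ge0.
apply: eq_eseriesr => k _.
rewrite (eq_integral (fun w => (u (X k w) ^+ 2)%:E)); last first.
  by move=> w /[!inE] Dk; rewrite YE// Dk.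
rewrite (integral_random_walk hd rwX (g := fun y => u y ^+ 2)) //.
- by rewrite -/(D k) (poisson_process_law k ppN t0).
- by move=> y; exact: sqr_ge0.
move=> y n.
(* A one-element list of times puts [D k] into the form in which independence is assumed. *)
have DE : [set w | forall s, s \in [:: t] -> N s w = k] = D k.
  apply/seteqP; split=> w h; first by apply: h; rewrite inE.
  by move=> s; rewrite inE => /eqP ->.
have := indep (iota 0 n.+1) [:: t] y (fun=> k) (@subsetT _ _).
rewrite DE => -> // s /=; by rewrite inE => /eqP ->.
Qed.

End ContinuousTimeRandomWalk.

(** * Termwise differentiation of a power series inside its disc of convergence *)

Section PowerSeries.
Context (R : realType).
Implicit Types (c : nat -> R) (x K : R).

(** With [K1] midway between [y] and the norm of [K], the bound
    [(n + 1) y^n <= K1^(n + 1) / (K1 - y)] dominates the differentiated series by the absolutely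
    convergent one at [K1]. *)
Lemma is_cvg_pseries_diffs c K x : cvgn (pseries c K) -> `|x| < `|K| ->
  cvgn (pseries (pseries_diffs c) x).
Proof.
move=> cK; set y := `|x| => xK; pose K1 := (y + `|K|) / 2.
have y0 : 0 <= y by exact: normr_ge0.
have yK1 : y < K1 by rewrite /K1; lra.
have K10 : 0 <= K1 by exact: le_trans (ltW yK1).
have K1K : `|K1| < `|K| by rewrite ger0_norm// /K1; lra.
have cK1 := is_cvg_pseries_inside_norm cK K1K.
apply: normed_cvg; rewrite /normed_series_of /=.
pose w n := `|c n| * K1 ^+ n.
apply: (@series_le_cvg _ _ (fun n => (K1 - y)^-1 * w n.+1)) => [n|n|n|].
- by rewrite normr_ge0.
- by rewrite mulr_ge0 ?invr_ge0 ?subr_ge0 ?(ltW yK1)// mulr_ge0// exprn_ge0.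
- have yn : n.+1%:R * y ^+ n <= (K1 - y)^-1 * K1 ^+ n.+1.
    rewrite ler_pdivlMl ?subr_gt0//.
    (* Factoring the right side leaves [n + 1] terms [K1^(n - i) y^i], each at least [y^n]. *)
    have : (K1 - y) * (n.+1%:R * y ^+ n) <= K1 ^+ n.+1 - y ^+ n.+1.
      rewrite subrXX ler_wpM2l ?subr_ge0 ?(ltW yK1)//.
      rewrite mulr_natl -[X in _ *+ X]card_ord -sumr_const.
      apply: ler_sum => -[i /= ilt] _.
      rewrite (_ : y ^+ n = y ^+ (n - i) * y ^+ i); last first.
        by rewrite -exprD subnK.
      by rewrite ler_wpM2r ?exprn_ge0// lerXn2r// ?nnegrE// ltW.
    move=> /le_trans; apply; rewrite gerBl; exact: exprn_ge0.
  rewrite /pseries_diffs /w !normrM normrX normr_nat -/y.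
  by rewrite [X in X * _]mulrC -mulrA [leRHS]mulrCA ler_wpM2l.
- rewrite (_ : series _ = fun n => (K1 - y)^-1 * (series w n.+1 - w 0%N)).
    apply: is_cvgM; first exact: is_cvg_cst.
    apply: (@is_cvgB _ _ _ _ _ (fun n => series w n.+1)); last first.
      exact: is_cvg_cst.
    by apply/cvg_ex; exists (limn (series w)); rewrite (cvg_shiftS (series w)).
  apply/funext => n; rewrite /series /= -mulr_sumr big_nat_recl//.
  by rewrite addrAC subrr add0r.
Qed.

Lemma is_derive_pseries c K x : cvgn (pseries c K) -> `|x| < `|K| ->
  is_derive x 1 (fun t => limn (pseries c t))
    (limn (pseries (pseries_diffs c) x)).
Proof.
(* [pseries_snd_diffs] asks for convergence of the series and of its first two formal derivatives at
   one point beyond [x]. Each formal differentiation shrinks the radius, hence two intermediate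
   radii, [K2] below [K1]. *)
move=> cK xK; pose K2 := (2 * `|x| + `|K|) / 3.
pose K1 := (`|x| + 2 * `|K|) / 3.
have x0 := normr_ge0 x.
have K20 : 0 <= K2 by rewrite /K2; lra.
have K10 : 0 <= K1 by rewrite /K1; lra.
have K1K : `|K1| < `|K| by rewrite ger0_norm// /K1; lra.
have K21 : `|K2| < `|K1| by rewrite !ger0_norm// /K1 /K2; lra.
have K2K : `|K2| < `|K| by exact: lt_trans K1K.
have xK2 : `|x| < `|K2| by rewrite (ger0_norm K20) /K2; lra.
apply: (@pseries_snd_diffs _ c K2) => //.
- exact: is_cvg_pseries_inside K2K.
- exact: is_cvg_pseries_diffs K2K.
- apply: is_cvg_pseries_diffs K21; exact: is_cvg_pseries_diffs K1K.
Qed.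

End PowerSeries.

(** * Poisson means of a sequence and their derivatives *)

Section PoissonMean.
Context (R : realType).
Implicit Types (a : nat -> R) (t : R).

(** The partial sums of the exponential generating function of [a]. *)
Definition egf a t : R^nat := pseries (fun n => a n / n`!%:R) t.

(** For [t >= 0], the expectation of [a] at a Poisson variable of parameter [t]. The formula also
    covers negative [t], so an ordinary two-sided derivative is available at [0]. *)
Definition poisson_mean a t : R := expR (- t) * limn (egf a t).

Lemma poisson_mean_nneseries a t : 0 <= t -> (forall n, 0 <= a n) ->
  ((\sum_(0 <= k <oo) (t ^+ k / k`!%:R * expR (- t) * a k)%:E)%E
    \is a fin_num) ->
  cvgn (egf a t) /\
  fine (\sum_(0 <= k <oo) (t ^+ k / k`!%:R * expR (- t) * a k)%:E)%E =
    poisson_mean a t.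
Proof.
move=> t0 a0 fin; set v := fun k => t ^+ k / k`!%:R * expR (- t) * a k.
have v0 k : 0 <= v k.
  by rewrite !mulr_ge0 ?exprn_ge0 ?invr_ge0 ?ler0n ?expR_ge0.
have cv : cvgn (series v).
  by apply: nnseries_is_cvg => //; rewrite ltey_eq fin.
have egfE : egf a t = expR t *: series v.
  rewrite -seriesZ /egf /pseries; congr series; apply/funext => n.
  rewrite /v /GRing.scale /= expRN.
  have := expR_gt0 t; move: (expR t) (t ^+ n) (n`!%:R^-1) => p q r p0.
  by rewrite -[RHS]/(p * _); field; rewrite gt_eqF.
have ce : cvgn (egf a t) by rewrite egfE; exact: is_cvgZl_tmp.
split=> //; rewrite /poisson_mean egfE limZl_tmp// /GRing.scale /= mulrA.
rewrite -expRD addNr expR0 mul1r -[RHS]/(fine (limn (series v))%:E).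
rewrite -EFin_lim//; congr fine; apply/congr_lim/funext => n /=.
by rewrite /series /= sumEFin.
Qed.

(** Differentiating an exponential generating function [G] shifts its sequence, the factor [n + 1]
    cancelling in the factorial. The product rule gives [e^-t (G' - G)], which belongs to the
    sequence [a (n + 1) - a n]. *)
Lemma is_derive_poisson_mean a K t : cvgn (egf a K) -> `|t| < `|K| ->
  cvgn (egf (discrete_derivative a) t) /\
  is_derive t 1 (poisson_mean a) (poisson_mean (discrete_derivative a) t).
Proof.
move=> cK tK; set c := fun n => a n / n`!%:R.
have diffsE : pseries_diffs c = fun n => a n.+1 / n`!%:R.
  apply/funext => n; rewrite /pseries_diffs /c factS natrM invfM mulrCA.
  by rewrite mulVKf.
have ct : cvgn (pseries c t) by exact: is_cvg_pseries_inside tK.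
have cdt : cvgn (pseries (pseries_diffs c) t).
  exact: is_cvg_pseries_diffs tK.
have egfE : egf (discrete_derivative a) t =
    pseries (pseries_diffs c) t - pseries c t.
  apply/funext => n.
  rewrite /egf /pseries /series /= /GRing.add /= /series /= -sumrB.
  apply: eq_bigr => i _.
  by rewrite diffsE /c /discrete_derivative !mulrBl.
split; first by rewrite egfE; exact: is_cvgB.
have dc := is_derive_pseries cK tK.
have de : is_derive t 1 (fun s => expR (- s)) (- expR (- t)).
  rewrite -mulrN1; apply: (@is_derive1_comp _ expR -%R).
rewrite /poisson_mean egfE limB//.
apply: (is_derive_eq (is_deriveM de dc)).
rewrite -[X in X + _]/(_ * _) -[X in _ + X]/(_ * _) /c /egf.
ring.
Qed.

Lemma poisson_mean_ge0 a t : 0 <= t -> (forall n, 0 <= a n) ->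
  cvgn (egf a t) -> 0 <= poisson_mean a t.
Proof.
move=> t0 a0 ct; rewrite mulr_ge0 ?expR_ge0// limr_ge//; apply: nearW => n.
by apply: sumr_ge0 => i _; rewrite !mulr_ge0 ?invr_ge0 ?exprn_ge0.
Qed.

End PoissonMean.

(** * Derivatives within [[0, T)] and absolute monotonicity of Poisson means *)

Lemma initial_interval_gt (R : realType) (T : \bar R) x :
  initial_interval T x -> exists2 z, initial_interval T z & x < z.
Proof.
case: T => [r| |] [x0]; rewrite ?lte_fin => xT.
- exists ((x + r) / 2); last by lra.
  by split; rewrite ?lte_fin; lra.
- by exists (x + 1); [split; [lra|rewrite ltry]|lra].
- by [].
Qed.

Section DerivativeWithin.
Context (R : realType) (T : \bar R).
Let A := initial_interval T.

(** At points of [A] the quotients of [f] are those of [g], whose two-sided limit survives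
    restriction to [A]; the substitution is [h = y - x]. *)
Lemma quotients_within_cvg (f g : R -> R) x l : A x ->
  (forall y, A y -> f y = g y) -> is_derive x 1 g l ->
  quotients_within A f x --> l.
Proof.
move=> Ax fg [dg gl].
have : (h^-1 *: ((g \o shift x) (h *: 1) - g x)) @[h --> 0^'] --> l.
  by rewrite -gl; exact: dg.
move=> /cvgrPdist_lt h; apply/cvgrPdist_lt => e e0.
have [r /= r0 hr] := h e e0.
exists r => //= y yr yx Ay.
have := hr (y - x); rewrite /= sub0r normrN distrC subr_eq0 => /(_ yr yx).
by rewrite fg// fg// -[_ *: 1]/(_ * 1) mulr1 subrK -[_ *: _]/(_ * _) mulrC.
Qed.

(** [A] extends to the right of each of its points, so it meets every punctured neighbourhood.
    Properness makes the limit defining [derivative_within] unique. *)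
Lemma within_dnbhs_proper x : A x -> ProperFilter (within A x^').
Proof.
move=> Ax; apply: Build_ProperFilter_ex => B [r /= r0 hr].
have [z [z0 zT] xz] := initial_interval_gt Ax.
pose y := Num.min z (x + r / 2).
have xy : x < y by rewrite lt_min xz; lra.
exists y; apply: hr => /=.
- have : y <= x + r / 2 by rewrite ge_min lexx orbT.
  by rewrite distrC gtr0_norm; lra.
- by rewrite gt_eqF.
- split; first by have [x0 _] := Ax; lra.
  by apply: le_lt_trans zT; rewrite lee_fin ge_min lexx.
Qed.

Lemma quotients_within_lim (f g : R -> R) x l : A x ->
  (forall y, A y -> f y = g y) -> is_derive x 1 g l ->
  derivative_within A f x = l.
Proof.
move=> Ax fg dg; have ? := within_dnbhs_proper Ax.
by apply: cvg_lim => //; exact: quotients_within_cvg fg dg.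
Qed.

Lemma absolutely_monotonic_poisson_mean (a : nat -> R) (f : R -> R) :
  (forall r, discrete_absolutely_monotonic r a) ->
  (forall t, A t -> cvgn (egf a t) /\ f t = poisson_mean a t) ->
  absolutely_monotonic A f.
Proof.
move=> am fa; pose b k := iter k (@discrete_derivative R) a.
have main k t : A t -> cvgn (egf (b k) t) /\
    nderivative_within A k f t = poisson_mean (b k) t.
  elim: k t => [|k IHk] t At; first exact: fa.
  (* The generating function converges at [z] by induction, so [t] lies strictly inside its disc of
     convergence, even for [t = 0]. *)
  have [z Az tz] := initial_interval_gt At.
  have tz' : `|t| < `|z| by rewrite !ger0_norm//; [case: Az|case: At].
  have [c der] := is_derive_poisson_mean (IHk z Az).1 tz'.
  split=> //; rewrite /nderivative_within iterS.
  by apply: quotients_within_lim der => // y /IHk[].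
split=> k t At; last first.
  have [c ->] := main k t At; apply: poisson_mean_ge0 => //.
    by case: At.
  by move=> n; exact: (am (k + n)%N).
have [z Az tz] := initial_interval_gt At.
have tz' : `|t| < `|z| by rewrite !ger0_norm//; [case: Az|case: At].
have [c der] := is_derive_poisson_mean (main k z Az).1 tz'.
have fb y : A y -> nderivative_within A k f y = poisson_mean (b k) y.
  by move=> Ay; have [] := main k y Ay.
exact: cvgP (quotients_within_cvg At fb der).
Qed.

End DerivativeWithin.

Theorem theorem1p8 (R : realType) (d : nat) (hd : (0 < d)%N)
    (disp : measure_display) (Omega : measurableType disp)
    (P : probability Omega R) :
  (forall X : nat -> Omega -> Z^d, simple_random_walk P X ->
    forall (r : nat) (u : Z^d -> R), harmonic_on_ball r u ->
      discrete_absolutely_monotonic r (fun n => fine (second_moment P u X n)))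
  /\
  (forall Y : R -> Omega -> Z^d, continuous_time_random_walk P Y ->
    forall (T : \bar R) (u : Z^d -> R), harmonic_on_lattice u ->
      (forall t, initial_interval T t -> second_moment P u Y t \is a fin_num) ->
      absolutely_monotonic (initial_interval T)
        (fun t => fine (second_moment P u Y t))).
Proof.
split=> [X rwX r u hu|Y rwY T u hu fin].
  (* The second moment is a real number here, so [fine] loses nothing. *)
  rewrite (_ : (fun _ => _) = mean_square u).
    apply: mean_square_absolutely_monotonic => //.
    exact: harmonic_on_ball_mean_value.
  by apply/funext => n; rewrite (second_moment_random_walk hd rwX).
(* Harmonicity on the lattice gives it on every ball, so differences of all orders are non-negative
   at every [n]. *)
have am r : discrete_absolutely_monotonic r (mean_square u).
  apply: mean_square_absolutely_monotonic => //.
  by apply: harmonic_on_ball_mean_value => // x _; exact: hu.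
apply: (absolutely_monotonic_poisson_mean am) => t At.
have [t0 _] := At; have := fin t At.
rewrite (second_moment_continuous_time hd u rwY t0).
by apply: poisson_mean_nneseries => // n; exact: (am n 0%N).
Qed.
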